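(* For each integer $k \geq 2$ there exists an $\varepsilon > 0$ such that for all integers $n$ and $c$ there exists a digraph $D$ with $|V(D)| \geq n$, $\chi(D) \geq c$, and minimum out-degree at least $\varepsilon |V(D)|$, such that $D$ does not contain a directed $k$-cycle as a subdigraph.
   Context: Digraphs have no loops and no parallel arcs (anti-parallel arcs allowed); $\chi(D)$ is the chromatic number of the underlying undirected graph; subdigraphs need not be induced. *)

(* Defs.v *)
From HB Require Import structures.
From mathcomp Require Import all_boot all_order all_algebra.
From mathcomp Require Import reals.

Set Implicit Arguments.
Unset Strict Implicit.
Unset Printing Implicit Defensive.

(* Antiparallel arcs are allowed: [arc] need not be antisymmetric. *)
Record digraph := Digraph {
  vertex :> finType;
  arc : rel vertex;
  arc_irr : irreflexive arc }.

Section Digraph.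
Variable D : digraph.

Definition outdeg (v : D) : nat := #|[set w | arc v w]|.

(* Out-degrees never exceed #|D|, so the default value #|D| does not affect
   the minimum when D is nonempty; it is 0 when D is empty. *)
Definition min_outdeg : nat := \big[minn/#|D|]_(v : D) outdeg v.

Definition underlying : rel D := fun x y => arc x y || arc y x.

Definition colorable (m : nat) : bool :=
  [exists f : {ffun D -> 'I_m},
    [forall x, forall y, underlying x y ==> (f x != f y)]].

Lemma colorable_card : exists m, colorable m.
Proof.
exists #|D|; apply/existsP; exists [ffun x => enum_rank x].
apply/forallP => x; apply/forallP => y; apply/implyP; rewrite !ffunE => xy.
apply/eqP => /enum_rank_inj exy.
by move: xy; rewrite exy /underlying arc_irr.
Qed.

Definition chromatic_number : nat := ex_minn colorable_card.

Definition has_dicycle (k : nat) : Prop :=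
  exists s : k.-tuple D, ucycle (@arc D) s.

End Digraph.

(* Main.v *)
(** Every vertex of the balanced blow-up of a directed [(k+1)]-cycle has
    out-degree linear in the order, and all dicycles of the blow-up have length
    divisible by [k+1].  Adding a transitive tournament on [c] vertices which
    dominates the blow-up forces [c] colours and creates no new dicycle. *)

Require Import Defs.
From mathcomp Require Import all_boot all_order all_algebra.
From mathcomp Require Import reals.
From mathcomp Require Import zify.
Import Order.TTheory GRing.Theory Num.Theory.

Lemma leq_min_outdeg (D : digraph) (d : nat) :
  d <= #|D| -> (forall v : D, d <= outdeg v) -> d <= min_outdeg D.
Proof.
move=> dD dv; rewrite /min_outdeg.
by apply: (big_ind (fun e => d <= e)) => // x y dx dy; rewrite leq_min dx.
Qed.

(** A proper colouring composed with [h] is injective, so it uses at least [c] colours. *)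
Lemma clique_chromatic (D : digraph) (c : nat) (h : 'I_c -> D) :
  (forall i j, i != j -> underlying (h i) (h j)) -> c <= chromatic_number D.
Proof.
move=> clique; rewrite /chromatic_number; case: ex_minnP => m /existsP[f fP] _.
have inj_fh : injective (f \o h).
  move=> i j /= eq_f; apply/eqP; apply: contraT => /clique hij.
  by have /forallP/(_ (h j))/implyP/(_ hij) := forallP fP (h i); rewrite eq_f eqxx.
by have := leq_card _ inj_fh; rewrite !card_ord.
Qed.

Section TournamentOverBlowup.
Variables (c k m : nat).
Hypothesis k_gt0 : 0 < k.

(** [inl] gives the tournament; [inr (a, x)] is copy [x] of vertex [a] of the cycle. *)
Definition tb_vertex : finType := ('I_c + 'I_k.+1 * 'I_m)%type.

Definition tb_arc : rel tb_vertex := fun u v =>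
  match u, v with
  | inl i, inl j => i < j
  | inl _, inr _ => true
  | inr _, inl _ => false
  | inr a, inr b => b.1 == a.1.+1 %[mod k.+1]
  end.

Lemma tb_arc_irr : irreflexive tb_arc.
Proof.
case=> [i|[a x]] /=; first by rewrite ltnn.
(* Cancelling [a] leaves [0 = 1] modulo [k.+1], which [0 < k] excludes. *)
by rewrite -(addn1 a) -[X in X == _ %[mod _]]addn0 eqn_modDl !modn_small.
Qed.

Definition tb_digraph := Digraph tb_arc_irr.

(** Each arc raises the tournament index by at least one, or advances the class by one modulo
    [k.+1]; no arc leaves the blow-up. *)
Lemma tb_path (u : tb_vertex) (p : seq tb_vertex) : path tb_arc u p ->
  match u, last u p with
  | inl i, inl j => i + size p <= j
  | inl _, inr _ => true
  | inr _, inl _ => false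
  | inr a, inr b => b.1 == a.1 + size p %[mod k.+1]
  end.
Proof.
elim: p u => [|v p IHp] u /=; first by case: u => [i|a]; rewrite addn0.
case/andP=> uv /IHp {IHp}.
case: u v uv => [i|a] [j|b] //= uv; case: (last _ _) => // w.
  by rewrite addnS; apply: leq_trans; rewrite -addSn leq_add2r.
by move/eqP->; rewrite addnS -addSn eqn_modDr.
Qed.

(** By [tb_path], a closed walk of length [k] would force [i + k <= i] in the tournament, or [k = 0]
    modulo [k.+1] in the blow-up. *)
Lemma tb_no_dicycle : ~ has_dicycle tb_digraph k.
Proof.
case=> -[[|x p] /= /eqP size_s]; first by have := k_gt0; rewrite -[X in _ < X]size_s.
case/andP=> /tb_path + _; case: x => [i|a]; rewrite last_rcons size_rcons size_s.
  by rewrite -[leqRHS]addn0 leq_add2l leqNgt k_gt0.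
by rewrite -[X in X == _ %[mod _]]addn0 eqn_modDl !modn_small // eq_sym gtn_eqF.
Qed.

Lemma tb_card : #|tb_digraph| = c + k.+1 * m.
Proof. by rewrite card_sum card_prod !card_ord. Qed.

Lemma tb_chromatic : c <= chromatic_number tb_digraph.
Proof.
apply: (@clique_chromatic tb_digraph c inl) => i j.
by rewrite /underlying /= -neq_ltn.
Qed.

Lemma tb_outdeg (v : tb_digraph) : m <= outdeg v.
Proof.
(* Each vertex dominates a whole class [b]: any class for a tournament vertex, the cyclically next
   one for a blow-up vertex. *)
have [b vb] : exists b, forall y, tb_arc v (inr (b, y)).
  case: v => [i|[a x]]; first by exists ord0.
  by exists (inord (a.+1 %% k.+1)) => y /=; rewrite inordK ?ltn_pmod // modn_mod.
have inj_b : injective (fun y : 'I_m => inr (b, y) : tb_vertex) by move=> y z [].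
rewrite -[m]card_ord -(card_imset _ inj_b).
by apply/subset_leq_card/subsetP => _ /imsetP[y _ ->]; rewrite inE; apply: vb.
Qed.

Lemma tb_min_outdeg : m <= min_outdeg tb_digraph.
Proof.
apply: leq_min_outdeg tb_outdeg.
by rewrite tb_card mulSn addnCA leq_addr.
Qed.

End TournamentOverBlowup.

Local Open Scope ring_scope.

Theorem theorem3p1 (R : realType) (k : nat) (hk : (2 <= k)%N) :
  exists eps : R, 0 < eps /\
    forall n c : int, exists D : digraph,
      [/\ n <= #|D|%:Z,
          c <= (chromatic_number D)%:Z,
          eps * #|D|%:R <= (min_outdeg D)%:R
        & ~ has_dicycle D k].
Proof.
have k_gt0 : (0 < k)%N by apply: ltnW.
exists (k.+2%:R^-1); split=> [|n c]; first by rewrite invr_gt0 ltr0n.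
(* The term [|n|] makes the order large enough; the term [|c|] keeps the tournament no larger than
   one class, so the order is at most [k.+2 * m], whence the choice of [eps]. *)
pose m := (`|n| + `|c|)%N.
exists (tb_digraph `|c| k m k_gt0); split.
- by rewrite tb_card; lia.
- by have := tb_chromatic `|c| k m k_gt0; lia.
- rewrite ler_pdivrMl ?ltr0n // -natrM ler_nat tb_card.
  apply: leq_trans (leq_mul (leqnn _) (tb_min_outdeg _ _ _ _)).
  by rewrite [leqRHS]mulSn leq_add2r leq_addl.
- exact: tb_no_dicycle.
Qed.
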